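(* Let $\alpha$ be an irrational real number. Then $B(\alpha)\leq 2$ and $B(2\alpha)\leq 2$ if and only if the continued fraction of $\alpha$ has one of the following two shapes, for some $n\geq 0$: (1) $\alpha=[a_0;a_1,\ldots,a_n,\overline{2}]$ with $q_n\equiv q_{n-1}\equiv 1\pmod 2$; (2) $\alpha=[a_0;a_1,\ldots,a_n,\overline{2,1}]$ with $q_{n-1}\equiv 0\pmod 2$.
   Context: For an irrational real $x=[a_0;a_1,a_2,\ldots]$, $B(x)=\limsup_{n\to\infty}a_n(x)$. For $\alpha=[a_0;a_1,a_2,\ldots]$, $q_n$ denotes the denominator of the $n$-th convergent $p_n/q_n=[a_0;a_1,\ldots,a_n]$, i.e. $q_{-1}=0$, $q_0=1$, $q_{n+1}=a_{n+1}q_n+q_{n-1}$. $\overline{2}$ and $\overline{2,1}$ denote the blocks $2$ and $2,1$ repeated forever. *)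

(* Defs.v *)
From HB Require Import structures.
From mathcomp Require Import all_boot all_order all_algebra.
From mathcomp Require Import all_classical all_reals all_analysis.

Set Implicit Arguments.
Unset Strict Implicit.
Unset Printing Implicit Defensive.

Import Order.TTheory GRing.Theory Num.Theory.
Local Open Scope ring_scope.

(* The complete quotients x_0 = x, x_(n+1) = 1 / (x_n - floor x_n).  When x is
   irrational, no x_n is an integer, so the inverse is always a genuine one. *)
Definition cf_complete (R : realType) (x : R) (n : nat) : R :=
  iter n (fun y : R => (y - (Num.floor y)%:~R)^-1) x.

(* a_n in x = [a_0; a_1, a_2, ...] *)
Definition cf_quot (R : realType) (x : R) (n : nat) : int :=
  Num.floor (cf_complete x n).

(* B(x), an extended real: it is +oo when the partial quotients are unbounded *)
Definition cf_limsup (R : realType) (x : R) : \bar R :=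
  limn_esup (fun n : nat => ((cf_quot x n)%:~R)%:E).

(* The pair (q_(n-1), q_n), starting from (q_(-1), q_0) = (0, 1) *)
Fixpoint cf_den_pair (R : realType) (x : R) (n : nat) : int * int :=
  if n is m.+1 then
    let: (q', q) := cf_den_pair x m in (q, cf_quot x m.+1 * q + q')
  else (0, 1).

Definition cf_den_prev (R : realType) (x : R) (n : nat) : int :=
  (cf_den_pair x n).1.

Definition cf_den (R : realType) (x : R) (n : nat) : int :=
  (cf_den_pair x n).2.

(* x = [a_0; a_1, ..., a_n, 2, 2, 2, ...] *)
Definition cf_tail_2 (R : realType) (x : R) (n : nat) : Prop :=
  forall k : nat, cf_quot x (n.+1 + k) = 2.

(* x = [a_0; a_1, ..., a_n, 2, 1, 2, 1, ...], the first period starting with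
   a_(n+1) = 2 *)
Definition cf_tail_21 (R : realType) (x : R) (n : nat) : Prop :=
  forall k : nat,
    cf_quot x (n.+1 + k.*2) = 2 /\ cf_quot x (n.+1 + k.*2.+1) = 1.

(* Main.v *)
Require Import Defs.
From HB Require Import structures.
From mathcomp Require Import all_boot all_order all_algebra.
From mathcomp Require Import all_classical all_reals all_analysis.
From mathcomp Require Import zify ring lra.

Set Implicit Arguments.
Unset Strict Implicit.
Unset Printing Implicit Defensive.

Import Order.TTheory GRing.Theory Num.Theory.
Local Open Scope ring_scope.

(** Write [x] for the complete quotient [x_(n+1)] of [alpha].  Depending on the
    parities of [(q_n, q_(n-1))], some complete quotient of [2 * alpha] is
    [2 x] or [2 x + 1] ([q_n] even), [c + 2 / x] with [c] an integer ([q_(n-1)]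
    even), or [(x + 1) / (x - 1)] (both odd).  If [q_n] is even and the partial
    quotients of [2 * alpha] are at most 2 there, then [2 x < 3], which forces
    [a_(n+1) = 1] and [a_(n+2) >= 2], hence [a_(n+2) = 2] and [q_(n+2)] even
    again: the tail is 1, 2, 1, 2, ...  If [q_n] is odd for all large [n], the
    recurrence makes every [a_n] even, hence 2.  Conversely, on both tails the
    three forms yield the partial quotients of [2 * alpha] explicitly. *)

(** * Parity of integers *)

Definition oddz (z : int) : bool := odd `|z|%N.

Lemma oddzD (x y : int) : oddz (x + y) = oddz x (+) oddz y.
Proof. rewrite /oddz; lia. Qed.

Lemma oddzM (x y : int) : oddz (x * y) = oddz x && oddz y.
Proof. by rewrite /oddz abszM oddM. Qed.

Lemma oddzP (z : int) : oddz z -> exists b : int, z = 2 * b + 1.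
Proof. by move=> h; exists (z %/ 2)%Z; move: h; rewrite /oddz; lia. Qed.

Lemma evenzP (z : int) : ~~ oddz z -> exists b : int, z = 2 * b.
Proof. by move=> h; exists (z %/ 2)%Z; move: h; rewrite /oddz; lia. Qed.

Lemma modz2_eq0 (z : int) : (z = 0 %[mod 2])%Z <-> ~~ oddz z.
Proof. rewrite /oddz; lia. Qed.

Lemma modz2_eq1 (z : int) : (z = 1 %[mod 2])%Z <-> oddz z.
Proof. rewrite /oddz; lia. Qed.

(** * Limit superior, complete quotients and denominators *)

Section ContinuedFraction.
Variable R : realType.
Implicit Types (x y z : R) (n k : nat) (a b c : int).

(** Partial quotients are integers, so a tail supremum below [c + 1] bounds every term of that tail
    by [c]. *)
Lemma cf_limsup_le_int x c :
  (cf_limsup x <= (c%:~R)%:E)%E <->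
  exists N, forall n, (N <= n)%N -> cf_quot x n <= c.
Proof.
rewrite /cf_limsup /limn_esup limf_esupE; split => [h|[N hN]].
  have /ereal_inf_lt[_ [V [N _ NV] <-] hV] :
      (ereal_inf [set ereal_sup ((fun n => ((cf_quot x n)%:~R : R)%:E) @` V)
        | V in \oo]%classic < ((c + 1)%:~R : R)%:E)%E.
    by apply: le_lt_trans h _; rewrite lte_fin ltr_int ltzD1.
  exists N => n Nn; rewrite -ltzD1 -(ltr_int R) -lte_fin.
  apply: le_lt_trans hV; apply: ereal_sup_ubound; exists n => //.
  exact: NV.
apply: (@le_trans _ _ (ereal_sup
  ((fun n => ((cf_quot x n)%:~R : R)%:E) @` [set n | (N <= n)%N])%classic)).
  apply: ereal_inf_lbound; exists [set n | (N <= n)%N]%classic => //.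
  by exists N.
by apply: ge_ereal_sup => _ [n Nn <-]; rewrite lee_fin ler_int; exact: hN.
Qed.

Lemma cf_complete_step y k c t :
  cf_complete y k = c%:~R + t -> 0 <= t < 1 ->
  cf_quot y k = c /\ cf_complete y k.+1 = t^-1.
Proof.
move=> yk /andP[t0 t1].
have q : cf_quot y k = c.
  by apply: floor_def; rewrite yk intrD; lra.
by split=> //; rewrite /cf_complete iterS -/(cf_complete y k) -/(cf_quot y k) q
  yk addrAC subrr add0r.
Qed.

Lemma irrational_int_neq x c : irrational x -> x <> c%:~R.
Proof. by move=> xirr xc; apply: xirr; exists c%:~R => //; rewrite ratr_int. Qed.

Lemma irrational_inv_sub_int x c : irrational x -> irrational (x - c%:~R)^-1.
Proof.
move=> xirr [q _ qE]; apply: xirr; exists (q^-1 + c%:~R) => //.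
by rewrite rmorphD /= fmorphV /= ratr_int qE invrK subrK.
Qed.

Lemma irrational_cf_complete x n : irrational x -> irrational (cf_complete x n).
Proof. by move=> xirr; elim: n => //= n; exact: irrational_inv_sub_int. Qed.

Lemma cf_completeE x n :
  cf_complete x n = (cf_quot x n)%:~R + (cf_complete x n.+1)^-1.
Proof. by rewrite /= invrK addrC subrK. Qed.

Lemma cf_complete_gt1 x n : irrational x -> 1 < cf_complete x n.+1.
Proof.
move=> xirr; set y := cf_complete x n.
have yirr : irrational y by exact: irrational_cf_complete.
have /andP[le lt] := floor_itv y.
rewrite -[cf_complete x n.+1]/((y - (Num.floor y)%:~R)^-1) invf_gt1.
  by move: lt; rewrite intrD; lra.
rewrite subr_gt0 lt_neqAle le andbT; apply/eqP => /esym.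
exact: irrational_int_neq.
Qed.

Lemma cf_quot_ge1 x n : irrational x -> 1 <= cf_quot x n.+1.
Proof.
move=> xirr; rewrite /cf_quot floor_ge_int.
exact/ltW/cf_complete_gt1.
Qed.

Lemma cf_den_prevS x n : cf_den_prev x n.+1 = cf_den x n.
Proof. by rewrite /cf_den_prev /cf_den /=; case: cf_den_pair. Qed.

Lemma cf_denS x n :
  cf_den x n.+1 = cf_quot x n.+1 * cf_den x n + cf_den_prev x n.
Proof. by rewrite /cf_den_prev /cf_den /=; case: cf_den_pair. Qed.

(** * Expansion steps for the shapes met when doubling *)

Lemma cf_step_half_inv y k b z : 1 < z ->
  cf_complete y k = b%:~R + (2 * z)^-1 ->
  cf_quot y k = b /\ cf_complete y k.+1 = 2 * z.
Proof.
move=> z1 /cf_complete_step; rewrite invrK; apply.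
by rewrite invr_ge0 invf_lt1; lra.
Qed.

Lemma cf_step_two_div y k c x : 2 < x ->
  cf_complete y k = c%:~R + 2 / x ->
  cf_quot y k = c /\ cf_complete y k.+1 = x / 2.
Proof.
move=> x2 /cf_complete_step; rewrite invf_div; apply.
by rewrite divr_ge0 ?ltr_pdivrMr; lra.
Qed.

Lemma cf_step_cayley y k c z : 1 < z ->
  cf_complete y k = c%:~R + (z - 1) / (z + 1) ->
  cf_quot y k = c /\ cf_complete y k.+1 = (z + 1) / (z - 1).
Proof.
move=> z1 /cf_complete_step; rewrite invf_div; apply.
by rewrite divr_ge0 ?ltr_pdivrMr; lra.
Qed.

(** The inverse of [(1 + z^-1) / 2] is [1 + (z - 1) / (z + 1)], so a quotient 1 is read between [b]
    and the final form. *)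
Lemma cf_step_half_add1 y k b z : 1 < z ->
  cf_complete y k = b%:~R + (1 + z^-1) / 2 ->
  cf_complete y k.+2 = (z + 1) / (z - 1).
Proof.
move=> z1 /cf_complete_step.
have zV : 0 < z^-1 < 1 by rewrite invr_gt0 invf_lt1; lra.
case; first lra.
move=> _ y1; apply: (@cf_step_cayley _ _ 1 _ z1 _).2.
rewrite y1; field; lra.
Qed.

(** * Tracking the doubled expansion by parities *)

(* The bounds on [n] force [k] to infinity with [n]. *)
Definition doubling_state (alpha : R) n k : Prop :=
  let x := cf_complete alpha n.+1 in
  let y := cf_complete (2 * alpha) k in
  if oddz (cf_den alpha n) then
    if oddz (cf_den_prev alpha n) then
      (n <= 3 * k)%N /\ y = (x + 1) / (x - 1)
    else (n <= 3 * k + 2)%N /\ exists c, y = c%:~R + 2 / x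
  else oddz (cf_den_prev alpha n) /\
       (n <= 3 * k + 1)%N /\ (y = 2 * x \/ y = 2 * x + 1).

(** Only two transitions keep [k]: from both odd, when [a = 1], to [q_n] even, and from [q_n] even
    to [q_(n-1)] even. The next one must increase [k]; hence the factor 3 and the offsets 0, 1,
    2. *)
Lemma doubling_state_step (alpha : R) n k : irrational alpha ->
  doubling_state alpha n k -> exists k', doubling_state alpha n.+1 k'.
Proof.
move=> airr; rewrite /doubling_state cf_den_prevS cf_denS oddzD oddzM.
have := cf_quot_ge1 n airr; have := cf_completeE alpha n.+1.
have := cf_complete_gt1 n.+1 airr.
set x := cf_complete alpha n.+1; set z := cf_complete alpha n.+2.
set a := cf_quot alpha n.+1 => z1 xE a1.
have zV : 0 < z^-1 < 1 by rewrite invr_gt0 invf_lt1; lra.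
have z0 : z != 0 by lra.
case: (oddz (cf_den alpha n)) => [|[-> [nk yk]]]; last first.
  rewrite andbF /=; exists k; split; first lia.
  case: yk => ->; rewrite xE.
    by exists (2 * a); rewrite intrM; ring.
  by exists (2 * a + 1); rewrite intrD intrM; ring.
case: (oddz (cf_den_prev alpha n)) => -[nk yk]; rewrite andbT ?addbT ?addbF.
  have [/oddzP|/evenzP] := boolP (oddz a) => /= -[b ab]; move: xE; rewrite ab.
    (* If [a = 1], then [(x + 1) / (x - 1) = 2 z + 1]; otherwise [x > 3] and the form splits as
       [1 + 2 / (x - 1)]. *)
    have [->|b0] := eqVneq b 0 => xE.
      exists k; split=> //; split; first lia.
      right; rewrite yk xE mulr0 add0r; field; lra.
    have b1 : 1 <= (b%:~R : R) by rewrite (ler_int _ 1); lia.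
    move: xE; rewrite intrD intrM => xE.
    have [||_ y1] := @cf_step_two_div (2 * alpha) k 1 (x - 1); [lra| |].
      rewrite yk; field; lra.
    have [|_ y2] := @cf_step_half_inv (2 * alpha) k.+1 b _ z1.
      rewrite y1 xE; field; lra.
    by exists k.+2; split=> //; split; [lia|left].
  (* For [a = 2], [2 / (x - 1)] exceeds 1, so the integer part is 2 instead of 1. *)
  have [b1|b1] := eqVneq b 1.
    rewrite b1 => xE.
    have [|_ y1] := @cf_step_cayley (2 * alpha) k 2 _ z1.
      rewrite yk xE; field; lra.
    by exists k.+1; split=> //; lia.
  have b2 : 2 <= (b%:~R : R) by rewrite (ler_int _ 2); lia.
  rewrite intrM => xE.
  have [||_ y1] := @cf_step_two_div (2 * alpha) k 1 (x - 1); [lra| |].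
    rewrite yk; field; lra.
  exists k.+3; split; first lia.
  apply: (@cf_step_half_add1 _ _ (b - 1)) => //.
  rewrite y1 xE intrD; field; lra.
case: yk => c yk.
have [/oddzP|/evenzP] := boolP (oddz a) => /= -[b ab]; move: xE; rewrite ab.
  (* If [a = 1], then [x < 2] and [2 / x] carries a unit into the integer part, hence [c + 1]. *)
  have [->|b0] := eqVneq b 0 => xE.
    have [|_ y1] := @cf_step_cayley (2 * alpha) k (c + 1) _ z1.
      rewrite yk xE intrD; field; lra.
    by exists k.+1; split=> //; lia.
  have b1 : 1 <= (b%:~R : R) by rewrite (ler_int _ 1); lia.
  move: xE; rewrite intrD intrM => xE.
  have [||_ y1] := @cf_step_two_div (2 * alpha) k c x => //; first lra.
  exists k.+3; split; first lia.
  apply: (@cf_step_half_add1 _ _ b) => //.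
  rewrite y1 xE; field; lra.
have b1 : 1 <= (b%:~R : R) by rewrite (ler_int _ 1); lia.
rewrite intrM => xE.
have [||_ y1] := @cf_step_two_div (2 * alpha) k c x => //; first lra.
have [|_ y2] := @cf_step_half_inv (2 * alpha) k.+1 b _ z1.
  rewrite y1 xE; field; lra.
by exists k.+2; split=> //; split; [lia|left].
Qed.

Lemma doubling_stateP (alpha : R) n : irrational alpha ->
  exists k, doubling_state alpha n k.
Proof.
move=> airr; elim: n => [|n [k]]; last exact: doubling_state_step.
exists 0%N; split=> //; exists (2 * cf_quot alpha 0).
by rewrite {1}/cf_complete /iter -[X in _ * X]/(cf_complete alpha 0)
  cf_completeE mulrDr intrM.
Qed.

(** * Doubling on the two tails *)

Lemma cf_complete_quot2_gt2 (alpha : R) n : irrational alpha ->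
  cf_quot alpha n = 2 -> 2 < cf_complete alpha n.
Proof.
move=> airr q2; rewrite cf_completeE q2 ltrDl invr_gt0.
exact: lt_trans (cf_complete_gt1 n airr).
Qed.

(** If [x = 2 + 1 / z], then [(x + 1) / (x - 1) = 2 + (z - 1) / (z + 1)]: the form reproduces itself
    with quotient 2. *)
Lemma cf_limsup_double_tail_2 (alpha : R) n k : irrational alpha ->
  cf_tail_2 alpha n ->
  cf_complete (2 * alpha) k =
    (cf_complete alpha n.+1 + 1) / (cf_complete alpha n.+1 - 1) ->
  (cf_limsup (2 * alpha) <= 2%:E)%E.
Proof.
move=> airr tail yk.
have step j : cf_complete (2 * alpha) (k + j) =
    (cf_complete alpha (n.+1 + j) + 1) / (cf_complete alpha (n.+1 + j) - 1) ->
    cf_quot (2 * alpha) (k + j) = 2 /\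
    cf_complete (2 * alpha) (k + j.+1) =
    (cf_complete alpha (n.+1 + j.+1) + 1) / (cf_complete alpha (n.+1 + j.+1) - 1).
  move=> yj; rewrite !addnS; have z1 := cf_complete_gt1 (n.+1 + j) airr.
  apply: cf_step_cayley => //.
  have xE := cf_completeE alpha (n.+1 + j); rewrite tail in xE.
  rewrite yj xE; field; lra.
have yE j : cf_complete (2 * alpha) (k + j) =
    (cf_complete alpha (n.+1 + j) + 1) / (cf_complete alpha (n.+1 + j) - 1).
  by elim: j => [|j IH]; [rewrite !addn0|case: (step j IH)].
apply/(cf_limsup_le_int _ 2); exists k => m km.
by rewrite -(subnKC km); case: (step _ (yE (m - k)%N)) => ->.
Qed.

(** If [x = 2 + 1 / z] and [z = 1 + 1 / w], then [x / 2 = 1 + 1 / (2 z)] and [2 z = 2 + 2 / w]: the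
    quotients 1, 2 lead from [x / 2] to [w / 2]. *)
Lemma cf_limsup_double_tail_21 (alpha : R) n k c : irrational alpha ->
  cf_tail_21 alpha n ->
  cf_complete (2 * alpha) k = c%:~R + 2 / cf_complete alpha n.+1 ->
  (cf_limsup (2 * alpha) <= 2%:E)%E.
Proof.
move=> airr tail yk.
have x2 j : 2 < cf_complete alpha (n.+1 + j.*2).
  by apply: cf_complete_quot2_gt2 => //; case: (tail j).
have step j : cf_complete (2 * alpha) (k.+1 + j.*2) =
    cf_complete alpha (n.+1 + j.*2) / 2 ->
    [/\ cf_quot (2 * alpha) (k.+1 + j.*2) = 1,
        cf_quot (2 * alpha) (k.+1 + j.*2).+1 = 2 &
        cf_complete (2 * alpha) (k.+1 + j.+1.*2) =
          cf_complete alpha (n.+1 + j.+1.*2) / 2].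
  move=> yj; have [q2 q1] := tail j.
  have z1 := cf_complete_gt1 (n.+1 + j.*2) airr.
  have := x2 j.+1; rewrite doubleS !addnS => w2; rewrite addnS in q1.
  have xE := cf_completeE alpha (n.+1 + j.*2); rewrite q2 in xE.
  have zE := cf_completeE alpha (n.+1 + j.*2).+1; rewrite q1 in zE.
  have [|-> y1] := @cf_step_half_inv (2 * alpha) (k.+1 + j.*2) 1 _ z1.
    rewrite yj xE; field; lra.
  have [|-> ->] := @cf_step_two_div (2 * alpha) (k.+1 + j.*2).+1 2 _ w2; last by [].
  by rewrite y1 zE; ring.
have yE j : cf_complete (2 * alpha) (k.+1 + j.*2) =
    cf_complete alpha (n.+1 + j.*2) / 2.
  elim: j => [|j IH]; last by case: (step j IH).
  rewrite !addn0; apply: (@cf_step_two_div _ _ c _ _ yk).2.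
  by have := x2 0%N; rewrite addn0.
apply/(cf_limsup_le_int _ 2); exists k.+1 => m km.
rewrite -(subnKC km) -(odd_double_half (m - k.+1)).
have [q1 q2 _] := step _ (yE (m - k.+1)./2).
by case: odd; rewrite ?add0n ?q1 // add1n addnS q2.
Qed.

(** * Even denominators and the classification *)

Lemma cf_quot_even_den (alpha : R) N n : irrational alpha ->
  (forall k, (N <= k)%N -> cf_quot (2 * alpha) k <= 2) ->
  (forall k, (N <= k)%N -> cf_quot alpha k <= 2) ->
  (3 * N + 2 <= n)%N -> ~~ oddz (cf_den alpha n) ->
  [/\ cf_quot alpha n.+1 = 1, cf_quot alpha n.+2 = 2 &
      ~~ oddz (cf_den alpha n.+2)].
Proof.
move=> airr h2a ha Nn evn.
have x1 := cf_complete_gt1 n airr; have z1 := cf_complete_gt1 n.+1 airr.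
have xlt : cf_complete alpha n.+1 < 3 / 2.
  have [k] := doubling_stateP n airr; rewrite /doubling_state (negbTE evn).
  (* From [3 N + 2 <= n <= 3 k + 1] it follows that [k] is past [N]. *)
  move=> [_ [nk yk]]; have /h2a : (N <= k)%N by lia.
  rewrite -ltzD1 /cf_quot floor_lt_int -[ltRHS]/(3 : R).
  by case: yk => ->; lra.
have q1 : cf_quot alpha n.+1 = 1 by apply: floor_def; rewrite intrD; lra.
have xE := cf_completeE alpha n.+1; rewrite q1 in xE.
(* The inverse of this complete quotient is [x_(n+1) - 1 < 1 / 2]. *)
have q2 : cf_quot alpha n.+2 = 2.
  apply/eqP; rewrite eq_le ha /=; last lia.
  by rewrite /cf_quot floor_ge_int -lef_pV2 ?posrE; lra.
split=> //; rewrite cf_denS oddzD oddzM q2 cf_den_prevS.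
by rewrite (negbTE evn).
Qed.

End ContinuedFraction.

Theorem theorem7p2 (R : realType) (alpha : R) (halpha : irrational alpha) :
  ((cf_limsup alpha <= 2%:E)%E /\ (cf_limsup (2 * alpha) <= 2%:E)%E) <->
  exists n : nat,
    (cf_tail_2 alpha n /\
     (cf_den alpha n = 1 %[mod 2])%Z /\ (cf_den_prev alpha n = 1 %[mod 2])%Z)
    \/
    (cf_tail_21 alpha n /\ (cf_den_prev alpha n = 0 %[mod 2])%Z).
Proof.
split=> [[]|[n]].
  move=> /(cf_limsup_le_int _ 2)[N1 h1] /(cf_limsup_le_int _ 2)[N2 h2].
  pose N := (N1 + N2)%N; pose M := (3 * N + 2)%N.
  have ha k : (N <= k)%N -> cf_quot alpha k <= 2 by move=> ?; apply: h1; lia.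
  have h2a k : (N <= k)%N -> cf_quot (2 * alpha) k <= 2.
    by move=> ?; apply: h2; lia.
  have even21 n := @cf_quot_even_den _ _ N n halpha h2a ha.
  have [[n Mn evn]|odds] := pselect
      (exists2 n, (M <= n)%N & ~~ oddz (cf_den alpha n)).
    have evens j : ~~ oddz (cf_den alpha (n + j.*2)).
      elim: j => [|j IH]; first by rewrite addn0.
      by rewrite doubleS !addnS; case: (even21 (n + j.*2)%N) => //; lia.
    (* The quotient [a_(n+1)] is 1 and the block 2, 1 starts at [a_(n+2)]; the shift also makes the
       even [q_n] the previous denominator. *)
    exists n.+1; right; rewrite cf_den_prevS; split; last exact/modz2_eq0.
    move=> j; split.
      by rewrite !addSn; case: (even21 _ _ (evens j)) => //; lia.
    have := evens j.+1; rewrite doubleS => /even21[|q1 _ _]; first lia.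
    by rewrite -q1; congr cf_quot; lia.
  have {}odds n : (M <= n)%N -> oddz (cf_den alpha n).
    by move=> Mn; apply/negPn/negP => evn; apply: odds; exists n.
  exists M.+1; left; rewrite cf_den_prevS; split; last first.
    by split; apply/modz2_eq1; apply: odds.
  move=> j; have Mj : (M <= M + j)%N by lia.
  (* In [q_(m+2) = a_(m+2) q_(m+1) + q_m] all denominators are odd, so [a_(m+2)] is even; lying
     between 1 and 2, it is 2. *)
  have := odds (M + j).+2; rewrite cf_denS oddzD oddzM cf_den_prevS.
  rewrite !odds ?andbT ?addbT; [|lia..].
  have := cf_quot_ge1 (M + j).+1 halpha.
  have := ha (M + j).+2; rewrite !addSn /oddz; lia.
move=> [[tail [/modz2_eq1 qo /modz2_eq1 qo']]|[tail /modz2_eq0 qe']].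
  split.
    apply/(cf_limsup_le_int _ 2); exists n.+1 => m nm.
    by rewrite -(subnKC nm) tail.
  have [k] := doubling_stateP n halpha.
  rewrite /doubling_state qo qo' => -[_].
  exact: cf_limsup_double_tail_2.
split.
  apply/(cf_limsup_le_int _ 2); exists n.+1 => m nm.
  rewrite -(subnKC nm) -(odd_double_half (m - n.+1)).
  have [q2 q1] := tail (m - n.+1)./2.
  by case: odd; rewrite ?add0n ?q2 // add1n q1.
have [k] := doubling_stateP n halpha.
(* The state excludes [q_n] and [q_(n-1)] both even, leaving the form [c + 2 / x]. *)
rewrite /doubling_state (negbTE qe'); case: ifP => [_ [_ [c]]|_ []//].
exact: cf_limsup_double_tail_21.
Qed.
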